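(* Let $(X,\rho)$ be a connected metric space which admits a connected dyadic cube decomposition. Let $d>0$ and let $\mu$ be a finite positive Borel measure on $X$ that is Ahlfors--David regular of dimension $d$. Then $X$ admits a weighted decomposition of order $d$. That is, there exists a constant $C^*>0$, depending only on $(X,\rho,\mu)$, such that for all positive numbers $\lambda_1,\dots,\lambda_n$ with $\sum_{j=1}^n\lambda_j=\mu(X)$ there exist measurable subsets $X_1,\dots,X_n\subset X$ such that $X=\bigsqcup_{j=1}^n X_j$ (disjoint union), $\mu(X_j)=\lambda_j$ for every $j$, and each $X_j$ is contained in a ball of radius $C^*\lambda_j^{1/d}$.
   Context: $B(x,R)$ denotes the open ball with centre $x$ and radius $R$. Ahlfors--David regular of dimension $d$: there is a constant $A\ge 1$ such that $A^{-1}r^d\le\mu(B(x,r))\le A r^d$ for all $x\in X$ and all $0<r\le\operatorname{diam}X$. A family of dyadic cubes of a metric space $(X,\rho)$ is a collection of subsets $Q_\alpha^k\subset X$, $k\in\mathbb{N}_0$, $\alpha\in I_k$ ($I_k$ index sets), for which there exist a ball constant $C>0$ and a scaling value $\delta\in(0,1)$ such that: (a) $X=\bigsqcup_{\alpha\in I_k}Q_\alpha^k$ for each $k\in\mathbb{N}_0$; (b) for each $l\ge k$, $\alpha\in I_l$, $\beta\in I_k$, either $Q_\alpha^l\subset Q_\beta^k$ or $Q_\alpha^l\cap Q_\beta^k=\emptyset$; (c) for each $Q_\alpha^k$ there is a point $x_\alpha^k\in Q_\alpha^k$ with $B(x_\alpha^k,C^{-1}\delta^k)\subseteq Q_\alpha^k\subseteq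 B(x_\alpha^k,C\delta^k)$. The family is connected if, in addition, (d) each $Q_\alpha^k$ is a connected subset of $X$. $X$ admits a connected dyadic cube decomposition if it has a connected family of dyadic cubes.
   Formalization: The space X is assumed to have at least two points: on a one-point space Ahlfors–David regularity is vacuous (diam X = 0), and a point mass cannot be split into two parts of positive measure. *)

(* Defs.v *)
From HB Require Import structures.
From mathcomp Require Import all_boot all_order all_algebra.
From mathcomp Require Import all_classical all_reals all_analysis.

Set Implicit Arguments.
Unset Strict Implicit.
Unset Printing Implicit Defensive.

Import Order.TTheory GRing.Theory Num.Theory.

Local Open Scope classical_set_scope.
Local Open Scope ring_scope.

(* Measurable types are pointed in the library, hence so are the metric spaces
   that carry a Borel measure. *)
#[short(type="metricPType")]
HB.structure Definition PointedMetric (R : numDomainType) :=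
  {M of Pointed M & Metric R M}.

Notation borel X := (g_sigma_algebraType (@open X)).

Definition disjoint_union (T I : Type) (A : set T) (F : I -> set T) : Prop :=
  A = \bigcup_(i in [set: I]) F i /\ trivIset [set: I] F.

(* Possibly infinite. *)
Definition diam (R : realType) (X : metricType R) : \bar R :=
  ereal_sup [set (mdist p.1 p.2)%:E | p in [set: X * X]].

(* Vacuous when X is a single point, since then diam X = 0. *)
Definition ahlfors_david_regular (R : realType) (X : metricPType R)
    (mu : {measure set (borel X) -> \bar R}) (d : R) : Prop :=
  exists2 A : R, 1 <= A & forall (x : X) (r : R),
    0 < r -> (r%:E <= diam X)%E ->
    ((A^-1 * r `^ d)%:E <= mu (ball x r))%E /\
    (mu (ball x r) <= (A * r `^ d)%:E)%E.

(* The cubes are arbitrary subsets: no measurability is required of them. *)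
Definition dyadic_cubes (R : realType) (X : metricType R)
    (I : nat -> Type) (Q : forall k, I k -> set X) : Prop :=
  exists C delta : R, [/\ 0 < C, 0 < delta < 1,
    (forall k, disjoint_union [set: X] (Q k)),
    (forall k l (a : I l) (b : I k), (k <= l)%N ->
       Q l a `<=` Q k b \/ Q l a `&` Q k b = set0) &
    (forall k (a : I k), exists x : X, [/\ Q k a x,
       ball x (C^-1 * delta ^+ k) `<=` Q k a &
       Q k a `<=` ball x (C * delta ^+ k)])].

Definition connected_dyadic_cubes (R : realType) (X : metricType R)
    (I : nat -> Type) (Q : forall k, I k -> set X) : Prop :=
  dyadic_cubes Q /\ forall k (a : I k), connected (Q k a).

Definition admits_connected_dyadic_cubes (R : realType) (X : metricType R) :
    Prop :=
  exists (I : nat -> Type) (Q : forall k, I k -> set X),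
    connected_dyadic_cubes Q.

Definition admits_weighted_decomposition (R : realType) (X : metricPType R)
    (mu : {measure set (borel X) -> \bar R}) (d : R) : Prop :=
  exists2 C : R, 0 < C & forall (n : nat) (lambda : 'I_n -> R),
    (forall j, 0 < lambda j) ->
    (\sum_(j < n) lambda j)%:E = mu [set: X] ->
    exists Y : 'I_n -> set (borel X),
      [/\ (forall j, measurable (Y j)),
          disjoint_union [set: X] Y,
          (forall j, mu (Y j) = (lambda j)%:E) &
          (forall j, exists x : X, Y j `<=` ball x (C * lambda j `^ d^-1))].

(* Main.v *)
(* The weights are served in increasing order, each one being given mass from a
   region of size [lambda ^ (1/d)]. Fix a cube and a point [z] of its closure.
   As long as the next weight is small, the children of the cube are processed
   one after the other; since the cube is connected, they can be ordered so that
   the closure of each one meets the closure of a later one; the mass left over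
   by a child is passed on near such a common point, the last child leaving it
   near [z]. Once the next weight is
   comparable to the mass of the cube itself, the cube is used as a whole: the
   mass received from outside is consumed first, so that what is left over lies
   in the cube. Because the weights increase, mass that travelled at one scale
   is only reused at the same or at a coarser scale, so displacements form a
   geometric series. In the end a region of the size of the next weight is left
   over, and all the remaining, larger weights are taken from it. *)
Require Import Defs.
From HB Require Import structures.
From mathcomp Require Import all_boot all_order all_algebra.
From mathcomp Require Import all_classical all_reals all_analysis.
From mathcomp Require Import ring lra.

Set Implicit Arguments.
Unset Strict Implicit.
Unset Printing Implicit Defensive.

Import Order.TTheory GRing.Theory Num.Theory.
Import numFieldNormedType.Exports.

Local Open Scope classical_set_scope.
Local Open Scope ring_scope.

(** * Carving sets of prescribed mass *)

Section FiniteMeasure.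
Context {disp : measure_display} {T : measurableType disp} {R : realType}.
Variable mu : {finite_measure set T -> \bar R}.
Implicit Types A B : set T.

Definition mass A : R := fine (mu A).

Lemma massE A : measurable A -> mu A = (mass A)%:E.
Proof. by move=> mA; rewrite fineK// fin_num_measure. Qed.

Lemma mass_ge0 A : 0 <= mass A.
Proof. exact: fine_ge0. Qed.

Lemma massU A B : measurable A -> measurable B -> A `&` B = set0 ->
  mass (A `|` B) = mass A + mass B.
Proof.
move=> mA mB AB0; apply: EFin_inj; rewrite EFinD -!massE//.
  by rewrite measureU.
exact: measurableU.
Qed.

Lemma massD A B : measurable A -> measurable B -> B `<=` A ->
  mass (A `\` B) = mass A - mass B.
Proof.
move=> mA mB BA; have mD : measurable (A `\` B) by exact: measurableD.
have := massU mB mD; rewrite setDE setICA setICr setI0 => /(_ erefl).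
by rewrite -setDE setDUK// => ->; rewrite addrC addKr.
Qed.

Lemma le_mass A B : measurable A -> measurable B -> A `<=` B ->
  mass A <= mass B.
Proof.
by move=> mA mB AB; rewrite -subr_ge0 -massD// mass_ge0.
Qed.

(** A quantitative absence of atoms, in the form in which small balls provide it. *)
Definition finely_divisible := forall e : R, 0 < e ->
  exists (n : nat) (E : nat -> set T),
  [/\ forall i, measurable (E i), forall i, mass (E i) <= e &
      \big[setU/set0]_(i < n) E i = [set: T]].

(** Adding the pieces of a fine cover to [B] one at a time leads to [A] in jumps of mass at most
    [e]; stop at the last stage of mass at most [t]. *)
Lemma approx_intermediate_set A B t e : finely_divisible ->
  measurable A -> measurable B -> B `<=` A ->
  mass B <= t <= mass A -> 0 < e ->
  exists C, [/\ measurable C, B `<=` C, C `<=` A & t - e <= mass C <= t].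
Proof.
move=> div mA mB BA /andP[Bt tA] e0; have [n [E [mE Ee EU]]] := div e e0.
pose F i := B `|` (A `&` \big[setU/set0]_(j < i) E j).
have mF i : measurable (F i).
  apply: measurableU => //; apply: measurableI => //.
  exact: bigsetU_measurable.
have FA i : F i `<=` A by rewrite /F => x [/BA//|[]].
have BF i : B `<=` F i by left.
have F0 : F 0%N = B by rewrite /F big_ord0 setI0 setU0.
have Fn : F n = A by rewrite /F EU setIT; exact/setUidPr.
have FS i : mass (F i.+1) <= mass (F i) + e.
  have sub : F i.+1 `<=` F i `|` (E i `\` F i).
    move=> x; rewrite /F big_ord_recr/= => -[Bx|[Ax [Ex|Ex]]].
    - by left; left.
    - by left; right.
    - by have [Fx|nFx] := pselect (F i x); [left|right].
  have mD : measurable (E i `\` F i) by exact: measurableD.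
  rewrite (le_trans (le_mass _ _ sub))//; first exact: measurableU.
  rewrite massU//; last by rewrite setDE setICA setICr setI0.
  rewrite lerD2l (le_trans _ (Ee i))// le_mass//; exact: subDsetl.
pose p i := (i <= n)%N && (mass (F i) <= t).
have p0 : exists i, p i by exists 0%N; rewrite /p F0 Bt.
have pn i : p i -> (i <= n)%N by case/andP.
case: (ex_maxnP p0 pn) => i /andP[ilen Fit] imax.
exists (F i); split => //; rewrite Fit andbT.
have [iltn|] := ltnP i n; last first.
  move=> nlei; have <- : n = i by apply/eqP; rewrite eqn_leq nlei ilen.
  by rewrite Fn; lra.
have : ~~ p i.+1 by apply/negP => /imax; rewrite ltnn.
rewrite /p iltn/= -ltNge; have := FS i; lra.
Qed.

(** Approximations with error [1/(n+1)], each containing the previous one, increase to a set of mass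
    exactly [t] by continuity from below. *)
Lemma intermediate_set A t : finely_divisible -> measurable A ->
  0 <= t <= mass A -> exists B, [/\ measurable B, B `<=` A & mass B = t].
Proof.
move=> div mA /andP[t0 tA].
pose ok (B : set T) := [/\ measurable B, B `<=` A & mass B <= t].
(* The state carries a counter because the required precision depends on the step. *)
have step (s : nat * {B | ok B}) : {s' : nat * {B | ok B} |
    [/\ s'.1 = s.1.+1, sval s.2 `<=` sval s'.2 &
        t - s.1.+1%:R^-1 <= mass (sval s'.2)]}.
  apply: cid; case: s => n [B [mB BA Bt]] /=.
  have [||C [mC BC CA /andP[tC Ct]]] :=
    @approx_intermediate_set A B t n.+1%:R^-1 div mA mB BA; first by rewrite Bt.
    by rewrite invr_gt0.
  have okC : ok C by [].
  by exists (n.+1, exist _ C okC).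
have ok0 : ok set0 by split; rewrite // /mass measure0.
have [s [s0 sS]] := dependent_choice step (0%N, exist _ set0 ok0).
have s1 n : (s n).1 = n.
  by elim: n => [|n ih]; [rewrite s0|have [-> _ _] := sS n; rewrite ih].
pose F n := sval (s n).2.
have mF n : measurable (F n) by rewrite /F; case: (s n).2 => ? [].
have FA n : F n `<=` A by rewrite /F; case: (s n).2 => ? [].
have Ft n : mass (F n) <= t by rewrite /F; case: (s n).2 => ? [].
have homoF : {homo F : n m / (n <= m)%N >-> (n <= m)%O}.
  apply: homo_leq => [?//|? ? ? |n]; first exact: le_trans.
  by rewrite subsetEset; have [] := sS n.
have mUF : measurable (\bigcup_n F n) by exact: bigcupT_measurable.
exists (\bigcup_n F n); split=> //; first by move=> x [n _ /FA].
have cF : mass (F n) @[n --> \oo] --> mass (\bigcup_n F n).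
  have : mu (F n) @[n --> \oo] --> (mass (\bigcup_n F n))%:E.
    by rewrite -massE//; exact: nondecreasing_cvg_mu.
  by move/fine_cvg.
have ct : mass (F n) @[n --> \oo] --> t.
  rewrite -(@cvg_shiftS _ (fun n => mass (F n) : R)).
  apply: (@squeeze_cvgr _ _ _ _ (fun n => t - harmonic n) (fun=> t)).
  - apply: nearW => n /=; rewrite Ft andbT.
    by have [_ _] := sS n; rewrite s1.
  - rewrite -[X in _ --> X]subr0.
    by apply: cvgB; [exact: cvg_cst|exact: cvg_harmonic].
  - exact: cvg_cst.
by apply: (cvg_unique _ cF ct); exact: norm_hausdorff.
Qed.


Section Allocation.
Variables (lam : nat -> R) (good : nat -> set T -> Prop).

(* [alloc i A j H]: pieces of masses [lam i], ..., [lam j.-1] have been carved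
   successively out of [A], and [H] is what is left. *)
Inductive alloc (i : nat) (A : set T) : nat -> set T -> Prop :=
| alloc_nil : alloc i A i A
| alloc_rcons j H Y : alloc i A j H -> measurable Y -> Y `<=` H ->
    mass Y = lam j -> good j Y -> alloc i A j.+1 (H `\` Y).

Lemma alloc_sub i A j H : alloc i A j H -> H `<=` A.
Proof. by elim=> // {}j {}H Y _ HA _ _ _ _ x [/HA]. Qed.

Lemma alloc_leq i A j H : alloc i A j H -> (i <= j)%N.
Proof. by elim=> // {}j {}H Y _ /leqW. Qed.

Lemma alloc_measurable i A j H :
  measurable A -> alloc i A j H -> measurable H.
Proof. by move=> mA; elim=> // {}j {}H Y _ mH mY _ _ _; exact: measurableD. Qed.

Lemma alloc_mass i A j H : measurable A -> alloc i A j H ->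
  mass A = \sum_(i <= l < j) lam l + mass H.
Proof.
move=> mA; elim=> [|{}j {}H Y aH -> mY YH Yj _].
  by rewrite big_geq// add0r.
rewrite big_nat_recr/= ?(alloc_leq aH)// massD ?Yj//; first by ring.
exact: alloc_measurable aH.
Qed.

Lemma alloc_trans i A j B k H : alloc i A j B -> alloc j B k H -> alloc i A k H.
Proof.
by move=> aB; elim=> // {}k {}H Y _ aH mY YH Yj gY; exact: alloc_rcons.
Qed.

(** A frame rule: [G] waits untouched while [A] is carved, so that one cube can be processed before
    another. *)
Lemma alloc_frame i A j H G : A `&` G = set0 -> alloc i A j H ->
  alloc i (A `|` G) j (H `|` G).
Proof.
move=> AG; elim=> [|{}j {}H Y aH aHG mY YH Yj gY]; first exact: alloc_nil.
have -> : H `\` Y `|` G = (H `|` G) `\` Y.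
  apply/seteqP; split=> x; last by case=> -[]; [left|right].
  case=> [[Hx nYx]|Gx]; split=> //; [by left|by right|move=> Yx].
  have : (A `&` G) x by split=> //; exact: (alloc_sub aH (YH _ Yx)).
  by rewrite AG.
by apply: alloc_rcons => //; exact: subset_trans YH (@subsetUl _ _ _).
Qed.

(* The set [G] is used up first: as long as a requested mass does not exceed
   [t], it can be completed inside [O] when [G] is exhausted. *)
Lemma alloc_drain N t j G O : finely_divisible ->
  measurable G -> measurable O -> G `&` O = set0 -> t < mass O ->
  (forall i, 0 < lam i) -> (j <= N)%N ->
  mass (G `|` O) <= \sum_(j <= i < N.+1) lam i ->
  (forall i Y, (j <= i)%N -> Y `<=` G `|` O -> good i Y) ->
  exists j' H, [/\ (j' <= N)%N, alloc j (G `|` O) j' H &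
    H `<=` O \/ t < lam j'].
Proof.
move=> div mG mO GO tO lam0 jN; move: (jN); rewrite -(subnKC jN).
move: (N - j)%N => n {N jN} _.
elim: n j G mG GO => [|n ih] j G mG GO mGO gd.
  exists j, (G `|` O); split; [by rewrite addn0|exact: alloc_nil|].
  (* A single weight remains; it is at least the whole mass, which exceeds [t]. *)
  by right; move: mGO; rewrite addn0 big_nat1 massU//; have := mass_ge0 G; lra.
have [ltj|lejt] := ltP t (lam j).
  by exists j, (G `|` O); split; [exact: leq_addr|exact: alloc_nil|right].
have rest Y : measurable Y -> Y `<=` G `|` O -> mass Y = lam j ->
    mass ((G `|` O) `\` Y) <= \sum_(j.+1 <= i < (j.+1 + n).+1) lam i.
  move=> mY YGO Yj; rewrite massD//; last exact: measurableU.
  rewrite Yj; move: mGO; rewrite big_ltn; last by rewrite ltnS leq_addr.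
  by rewrite addSnnS lerBlDl.
have [ljG|Glj] := leP (lam j) (mass G).
- have [|Y [mY YG Yj]] := @intermediate_set G (lam j) div mG.
    by rewrite ltW//= lam0.
  have YGO : Y `<=` G `|` O by move=> x /YG; left.
  have GYO : (G `|` O) `\` Y = (G `\` Y) `|` O.
    apply/seteqP; split=> x; first by case=> -[Gx|Ox] Yx; [left|right].
    case=> [[Gx nY]|Ox]; split=> //; [by left|by right|move=> /YG Gx].
    by have : (G `&` O) x by []; rewrite GO.
  have [||||j' [H [j'N aH HO]]] := ih j.+1 (G `\` Y).
  + exact: measurableD.
  + by apply/seteqP; split=> // x [[Gx _] Ox]; rewrite -GO; split.
  + by rewrite -GYO; exact: rest.
  + move=> i Z ji ZGO; apply: gd; first exact: ltnW.
    by apply: subset_trans ZGO _; rewrite -GYO; exact: subDsetl.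
  exists j', H; split=> //; first by rewrite addSnnS in j'N.
  apply: alloc_trans aH; rewrite -GYO; apply: alloc_rcons => //.
    exact: alloc_nil.
  exact: gd.
(* The piece is all of [G] completed by a part of [O], which is possible since
   [lam j <= t < mass O]. *)
- have [|Z [mZ ZO Zj]] := @intermediate_set O (lam j - mass G) div mO.
    by have := mass_ge0 G; lra.
  exists j.+1, ((G `|` O) `\` (G `|` Z)); split.
  + by rewrite addnS ltnS leq_addr.
  + have YGO : G `|` Z `<=` G `|` O by apply: setUS.
    apply: alloc_rcons => //; [exact: alloc_nil|exact: measurableU| |exact: gd].
    rewrite massU ?Zj//; first by ring.
    by apply/seteqP; split=> // x [Gx /ZO Ox]; rewrite -GO; split.
  + by left=> x [[Gx|//] nGx]; case: nGx; left.
Qed.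

Lemma alloc_all N j H : finely_divisible -> measurable H ->
  (forall i, 0 < lam i) -> (j <= N)%N ->
  mass H = \sum_(j <= i < N.+1) lam i ->
  (forall i Y, (j <= i)%N -> Y `<=` H -> good i Y) ->
  alloc j H N.+1 set0.
Proof.
move=> div mH lam0 jN; rewrite -(subnKC jN).
move: (N - j)%N => n {N jN}.
elim: n j H mH => [|n ih] j H mH mHE gd.
  (* The last piece is all of [H], so that the left-over is empty and not merely null. *)
  rewrite -[X in alloc _ _ _ X](setDv H) addn0; apply: alloc_rcons => //.
  - exact: alloc_nil.
  - by rewrite mHE addn0 big_nat1.
  - exact: gd.
have jn : (j < (j + n.+1).+1)%N by rewrite ltnS leq_addr.
move: mHE; rewrite big_ltn// => mHE.
have sum_ge0 : 0 <= \sum_(j.+1 <= i < (j + n.+1).+1) lam i.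
  by apply: sumr_ge0 => i _; exact: ltW.
have [|Y [mY YH Yj]] := @intermediate_set H (lam j) div mH.
  by rewrite ltW//= mHE lerDl.
have aY : alloc j H j.+1 (H `\` Y).
  by apply: alloc_rcons => //; [exact: alloc_nil|exact: gd].
apply: alloc_trans aY _; rewrite -addSnnS; apply: ih.
- exact: measurableD.
- by rewrite massD// mHE Yj addrC addKr addSnnS.
- move=> i Z ji ZHY; apply: gd; first exact: ltnW.
  exact: subset_trans ZHY (@subDsetl _ _ _).
Qed.

Lemma alloc_pieces i A j H : alloc i A j H -> exists Z : nat -> set T,
  [/\ forall l, (i <= l < j)%N ->
        [/\ measurable (Z l), mass (Z l) = lam l & good l (Z l)],
      trivIset [set l | (i <= l < j)%N] Z &
      A `\` H = \bigcup_(l in [set l | (i <= l < j)%N]) Z l].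
Proof.
elim=> [|{}j {}H Y aH [Z [Zl Ztriv ZA]] mY YH Yj gY].
  exists (fun=> set0); split=> [l|l m|].
  - by case/andP => /leq_ltn_trans/[apply]; rewrite ltnn.
  - by move=> _ _ [x []].
  - rewrite setDv; apply/seteqP; split=> // x [l /=].
    by case/andP => /leq_ltn_trans/[apply]; rewrite ltnn.
have ij := alloc_leq aH.
pose Z' l := if l == j then Y else Z l.
have Z'l l : (i <= l < j)%N -> Z' l = Z l.
  by case/andP => _ lj; rewrite /Z' ltn_eqF.
have rng l : (i <= l < j.+1)%N -> l <> j -> (i <= l < j)%N.
  by rewrite ltnS => /andP[-> lj] /eqP nlj; rewrite ltn_neqAle nlj lj.
have ZY l : (i <= l < j)%N -> Z l `&` Y = set0.
  move=> lj; apply/seteqP; split=> // x [Zx /YH Hx].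
  have : (\bigcup_(l in [set l | (i <= l < j)%N]) Z l) x by exists l.
  by rewrite -ZA => -[].
exists Z'; split=> [l|l m /= ll mm|].
- move=> lij; have [->|/eqP lj] := eqVneq l j; first by rewrite /Z' eqxx.
  by rewrite (Z'l l (rng _ lij lj)); exact: Zl (rng _ lij lj).
- have [->|/eqP lj] := eqVneq l j; have [->//|/eqP mj] := eqVneq m j.
  + rewrite (Z'l m (rng _ mm mj)) /Z' eqxx => -[x [Yx Zx]].
    by have : (Z m `&` Y) x by []; rewrite (ZY _ (rng _ mm mj)).
  + rewrite (Z'l l (rng _ ll lj)) /Z' eqxx => -[x [Zx Yx]].
    by have : (Z l `&` Y) x by []; rewrite (ZY _ (rng _ ll lj)).
  + rewrite (Z'l l (rng _ ll lj)) (Z'l m (rng _ mm mj)) => Zlm.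
    by apply: Ztriv => //=; exact: rng.
- apply/seteqP; split=> x.
    move=> [Ax nHY]; have [Yx|nYx] := pselect (Y x).
      by exists j; rewrite /= ?ij ?ltnS ?leqnn// /Z' eqxx.
    have : (A `\` H) x by split=> // Hx; apply: nHY.
    rewrite ZA => -[l /= lij Zx]; exists l; last by rewrite Z'l.
    by rewrite /= ltnS; case/andP: lij => -> /ltnW ->.
  move=> [l /= lij]; have [->|/eqP lj] := eqVneq l j.
    rewrite /Z' eqxx => Yx; split; first by apply: (alloc_sub aH); exact: YH.
    by case.
  rewrite (Z'l l (rng _ lij lj)) => Zx.
  have : (A `\` H) x by rewrite ZA; exists l => //=; exact: rng.
  by case=> Ax nHx; split=> // -[].
Qed.

End Allocation.

(** An infinite [J] contains a copy of [nat]; the first [n] sets along it have total mass at least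
    [n * c], which is eventually too much. *)
Lemma finite_disjoint_mass (J : Type) (B : J -> set T) (c : R) : 0 < c ->
  (forall a, measurable (B a)) -> trivIset [set: J] B ->
  (forall a, c <= mass (B a)) -> finite_set [set: J].
Proof.
move=> c0 mB trivB cB; apply: contrapT => /infiniteP/card_leP[f].
pose g n : J := \val (f (SigSub (mem_set (I : [set: nat]%classic n)))).
have ginj : injective g.
  by move=> n m /val_inj /inj; rewrite !in_setT => /(_ isT isT)/(congr1 val).
pose U n := \big[setU/set0]_(i < n) B (g i).
have mU n : measurable (U n) by exact: bigsetU_measurable.
have Uc n : n%:R * c <= mass (U n).
  elim: n => [|n ih]; first by rewrite mul0r mass_ge0.
  rewrite /U big_ord_recr/= -/(U n) massU//.
    by rewrite -natr1 mulrDl mul1r lerD.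
  apply/seteqP; split=> // x [Ux Bn].
  have [i /= ltin Bi] : (\bigcup_(i < n) B (g i)) x by rewrite bigcup_mkord.
  have : g i = g n by apply: (trivB _ _ I I); exists x.
  by move/ginj => /eqP; rewrite ltn_eqF.
have [n] : exists n : nat, mass [set: T] / c < n%:R.
  exists (Num.bound (mass [set: T] / c)); apply: archi_boundP.
  by rewrite divr_ge0 ?mass_ge0// ltW.
rewrite ltr_pdivrMr// ltNge => /negP; apply.
by apply: le_trans (Uc n) _; exact: le_mass.
Qed.
End FiniteMeasure.

(** * Chains in a connected union *)

Section Gluing.
Context {T : topologicalType}.

Lemma closure_bigcup_fin (I : finType) (F : I -> set T) (S : set I) z :
  closure (\bigcup_(i in S) F i) z -> exists2 i, S i & closure (F i) z.
Proof.
move=> clz; apply: contrapT => /forall2NP nz.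
have Fnear i : \forall x \near z, S i -> ~ F i x.
  have [nSi|Fz] := nz i; first by apply: nearW => x /nSi.
  move/existsNP : Fz => [V /not_implyP[Vz /set0P/negP]].
  rewrite negbK => /eqP VF.
  near=> x => _ Fx; suff : (F i `&` V) x by rewrite VF.
  by split=> //; near: x.
have : \forall x \near z, forall i, S i -> ~ F i x by exact: filter_forall.
by move=> /clz [x [[i Si Fix] /(_ i Si)]]; exact.
Unshelve. all: by end_near. Qed.

Lemma connected_gluing m (F : 'I_m -> set T) (P : set T -> T -> Prop) :
  (forall i, F i !=set0) -> trivIset [set: 'I_m] F ->
  connected (\bigcup_i F i) ->
  (forall i z, closure (F i) z -> P (F i) z) ->
  (forall U V z' z, U `&` V = set0 -> closure V z' -> P U z' -> P V z ->
    P (U `|` V) z) ->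
  forall z, closure (\bigcup_i F i) z -> P (\bigcup_i F i) z.
Proof.
move=> F0 trivF cF PF join z clz.
have [i0 _ cli0] := closure_bigcup_fin clz.
suff main n (S : {set 'I_m}) : (#|~: S| <= n)%N -> i0 \in S ->
    P (\bigcup_(i in [set` S]) F i) z -> P (\bigcup_i F i) z.
  apply: (main _ [set i0]%SET) => //; first by rewrite inE.
  suff -> : \bigcup_(i in [set` [set i0]%SET]) F i = F i0 by exact: PF.
  apply/seteqP; split=> x; last by exists i0; rewrite //= inE.
  by case=> i /=; rewrite inE => /eqP ->.
elim: n S => [|n ih] S.
  rewrite leqn0 cards_eq0 => /eqP SC _ PS; suff <- : [set` S] = setT by [].
  by apply/seteqP; split=> // i _ /=; rewrite -[S]finset.setCK SC !inE.
move=> Sn i0S PS.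
have [S0|/set0Pn[i1 i1S]] := eqVneq (~: S)%SET finset.set0.
  by apply: (ih S) => //; rewrite S0 cards0.
suff [i [x [iS xi xS]]] : exists i x, [/\ i \notin S, closure (F i) x &
    closure (\bigcup_(i in [set` S]) F i) x].
  apply: (ih (i |: S)%SET); last 2 first.
  - by rewrite !inE i0S orbT.
  - have -> : \bigcup_(j in [set` (i |: S)%SET]) F j =
        F i `|` \bigcup_(j in [set` S]) F j.
      apply/seteqP; split=> y.
        case=> j /=; rewrite !inE => /orP[/eqP->|jS] Fy; first by left.
        by right; exists j.
      case=> [Fy|[j jS Fy]]; first by exists i; rewrite //= !inE eqxx.
      by exists j => //=; rewrite !inE; move: jS => /= ->; rewrite orbT.
    apply: join xS _ PS; last exact: PF.
    apply/seteqP; split=> // y [Fiy [j jS Fjy]].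
    have ij : i = j by apply: (trivF i j) => //; exists y.
    by move: iS; rewrite ij; move: jS => /= ->.
  - rewrite -ltnS (leq_trans _ Sn)//; apply: proper_card.
    rewrite finset.setCU; apply/properP; split; first exact: subsetIr.
    by exists i; rewrite !inE ?eqxx.
pose A := \bigcup_(i in [set` S]) F i.
pose B := \bigcup_(i in [set` ~: S]%SET) F i.
have AB : \bigcup_i F i = A `|` B.
  apply/seteqP; split=> y.
    case=> i _ Fy; have [iS|iS] := boolP (i \in S); first by left; exists i.
    by right; exists i => //=; rewrite inE.
  by case=> -[i _ Fy]; exists i.
have : ~ separated A B.
  move=> sepAB; move: cF; apply/connectedPn.
  exists (fun b => if b then B else A); split=> //.
  by case; [have [y] := F0 i1; exists y, i1|have [y] := F0 i0; exists y, i0].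
move=> /not_andP[] /eqP/set0P[x [xA xB]].
- have [i /=] := xB; rewrite inE => iS Fix.
  by exists i, x; split=> //; exact: subset_closure.
- have [i /=] := closure_bigcup_fin xB; rewrite inE => iS Fix.
  by exists i, x; split=> //; exact: subset_closure.
Qed.

End Gluing.

Lemma finite_set_enum (T : Type) (D : set T) : finite_set D ->
  exists m, exists2 g : 'I_m -> T, injective g & range g = D.
Proof.
move=> /finite_setP[m /card_set_bijP[f [fD finj fsurj]]]; exists m.
have /choice[g gP] (i : 'I_m) : exists a, D a /\ f a = i.
  by have [a Da fa] := fsurj i (ltn_ord i); exists a.
exists g.
- move=> i j gij; apply: val_inj => /=.
  by have [_ <-] := gP i; have [_ <-] := gP j; rewrite gij.
- apply/seteqP; split=> [_ [i _ <-]|a Da]; first by have [] := gP i.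
  exists (Ordinal (fD a Da)) => //; have [Dg fg] := gP (Ordinal (fD a Da)).
  by apply: finj => //; rewrite inE.
Qed.

(** * Filling cubes with weights *)

Section Thickening.
Context {R : realType} {X : metricPType R}.
Implicit Types (U V : set X) (x y z : X) (r s : R).

(** A union of open balls, hence Borel even when [U] is not. *)
Definition thickening U r : set X := \bigcup_(u in U) ball u r.

Lemma open_metric_ball x r : open (ball x r).
Proof.
rewrite openE => y; rewrite ballEmdist/= => xy.
apply/nbhs_ballP; exists (r - mdist x y) => /=; first by rewrite subr_gt0.
move=> t; rewrite !ballEmdist/= ltrBrDl => yt.
exact: le_lt_trans (metric_triangle x y t) yt.
Qed.

Lemma open_borel U : open U -> measurable (U : set (borel X)).
Proof. by move=> oU; exact: sub_sigma_algebra. Qed.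

Lemma measurable_thickening U r : measurable (thickening U r : set (borel X)).
Proof.
by apply: open_borel; apply: bigcup_open => u _; exact: open_metric_ball.
Qed.

Lemma thickeningS U V r s : U `<=` V -> r <= s ->
  thickening U r `<=` thickening V s.
Proof. by move=> UV rs y [u /UV Vu uy]; exists u => //; exact: le_ball uy. Qed.

Lemma thickening_ball U x r s :
  U `<=` ball x s -> thickening U r `<=` ball x (s + r).
Proof. by move=> Us y [u /Us xu uy]; exact: ball_triangle xu uy. Qed.

(** The strict inequality in an open ball leaves room to replace [z] by a point of [U]. Thus mass
    delivered near a common closure point of two cubes is near the next cube. *)
Lemma ball_thickening U z r : closure U z -> ball z r `<=` thickening U r.
Proof.
move=> clz y; rewrite ballEmdist/= => zy.
have rzy : 0 < r - mdist z y by rewrite subr_gt0.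
have [u [Uu]] := clz _ (nbhsx_ballx z _ rzy).
rewrite ballEmdist/= ltrBrDr => zu; exists u => //; rewrite ballEmdist/=.
by rewrite (le_lt_trans (metric_triangle u z y))// (metric_sym u).
Qed.

Lemma closure_sub_ball U x z s : 0 < s -> U `<=` ball x s -> closure U z ->
  U `<=` ball z (3 * s).
Proof.
move=> s0 Us clz y /Us xy; have [u [/Us xu zu]] := clz _ (nbhsx_ballx z _ s0).
have -> : 3 * s = s + s + s by ring.
by apply: ball_triangle xy; apply: ball_triangle zu _; exact: ball_sym.
Qed.

End Thickening.

Section Filling.
Context {R : realType} {X : metricPType R}.
Variable mu : {finite_measure set (borel X) -> \bar R}.
Hypothesis div : finely_divisible mu.
Variables (N K : nat) (lam radius : nat -> R).
Hypothesis lam_gt0 : forall i, 0 < lam i.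
Hypothesis lam_homo : {homo lam : i j / (i <= j)%N >-> i <= j}.
(** A weight is small for generation [k] when it is at most [w k]; none is small for [K.+1]. For
    [w k.+1 < t <= w k] with [k <= K], the hypotheses force [rad t = E * delta ^+ k], the distance
    over which mass may travel when the next weight is [t]. *)
Variables (C delta eps : R) (w : nat -> R) (rad : R -> R) (pi : X -> X).
Hypothesis C_gt0 : 0 < C.
Hypothesis delta01 : 0 < delta < 1.
Hypothesis wK : w K.+1 < lam 0.
Hypothesis rad_homo : {homo rad : s t / s <= t}.
(** The sum of the geometric series with terms [4 * C * delta ^+ k]. *)
Let E := 4 * C / (1 - delta).
Hypothesis rad_le : forall k t, (k <= K)%N -> t <= w k ->
  rad t <= E * delta ^+ k.
Hypothesis rad_ge : forall k t, (k <= K)%N -> w k.+1 < t ->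
  E * delta ^+ k <= rad t.
Hypothesis measurable_pi : forall U : set X,
  measurable (pi @^-1` U : set (borel X)).
Hypothesis pi_near : forall y, mdist (pi y) y < eps.
Hypothesis epsK : eps <= C * delta ^+ K.
Hypothesis radius_ge : forall k i, (k <= K)%N -> w k.+1 < lam i ->
  (E + C) * delta ^+ k <= radius i.

(* Cubes need not be measurable. Instead, [X] is cut into tiny measurable pieces
   on which [pi] is constant, and [U] owns the pieces whose [pi]-value lies in
   it; ownership is exactly additive. *)
Let own (U : set X) : set (borel X) := pi @^-1` U.
Let good i (Y : set (borel X)) := exists x : X, Y `<=` ball x (radius i).

(* [G] is mass received from outside, located near [U] at the scale of the next
   weight. Either everything that is left over can be handed on near [z] at the
   scale of the next weight [lam j'], or this weight is too large for the
   generation [k] and the whole cube at generation [k.-1] will deal with it. *)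
Definition fillable k (U : set X) (z : X) := forall j (G : set (borel X)),
  (j <= N)%N -> lam j <= w k -> measurable G -> G `&` own U = set0 ->
  G `<=` thickening U (rad (lam j)) ->
  mass mu (G `|` own U) <= \sum_(j <= i < N.+1) lam i ->
  exists j' (H : set (borel X)), [/\ (j' <= N)%N,
    alloc mu lam good j (G `|` own U) j' H,
    H `<=` thickening U (E * delta ^+ k) &
    lam j' <= w k -> H `<=` ball z (rad (lam j'))].

Let delta_gt0 : 0 < delta. Proof. by case/andP: delta01. Qed.

Let E_ge : 4 * C <= E.
Proof.
rewrite ler_pdivlMr; last by rewrite subr_gt0; case/andP: delta01.
by rewrite ler_piMr ?mulr_ge0 ?ltW// gtrBl.
Qed.

(** Displacement at generation [k.+1] plus the crossing of a cube of generation [k] fits into the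
    allowance [E * delta ^+ k]. *)
Let E_step : E * delta + 3 * C <= E.
Proof.
have : E * (1 - delta) = 4 * C.
  by rewrite /E mulfVK// subr_eq0 gt_eqF//; case/andP: delta01.
move: C_gt0; lra.
Qed.

Let eps_le k : (k <= K)%N -> eps <= C * delta ^+ k.
Proof.
move=> kK; apply: le_trans epsK _; rewrite ler_pM2l//.
by apply: ler_wiXn2l => //; rewrite ltW//; case/andP: delta01.
Qed.

Let pi_thickening U r : eps <= r -> own U `<=` thickening U r.
Proof.
move=> er y Uy; exists (pi y) => //; rewrite ballEmdist/=.
exact: lt_le_trans er.
Qed.

Let thick_le k : (k <= K)%N -> eps <= E * delta ^+ k.
Proof.
move=> /eps_le/le_trans; apply; rewrite ler_pM2r ?exprn_gt0//.
by move: C_gt0 E_ge; lra.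
Qed.

(** Vacuous, as every weight exceeds [w K.+1]; this starts the induction over generations. *)
Lemma fillable_last U z : fillable K.+1 U z.
Proof.
move=> j G jN lamj; have := lam_homo (leq0n j); move: wK lamj; lra.
Qed.

(* [U] is filled first and hands on its remainder near [z'], hence near [V]. *)
Lemma fillableU k U V z' z : (k <= K)%N -> U `&` V = set0 -> closure V z' ->
  fillable k U z' -> fillable k V z -> fillable k (U `|` V) z.
Proof.
move=> kK UV clz' fU fV j G jN jk mG.
rewrite /own preimage_setU -/(own U) -/(own V) => GUV Gsub mGUV.
set OU := own U in GUV mGUV *; set OV := own V in GUV mGUV *.
have mOU : measurable OU by exact: measurable_pi.
have mOV : measurable OV by exact: measurable_pi.
have OUV : OU `&` OV = set0.
  by rewrite /OU /OV /own -preimage_setI UV preimage_set0.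
(* The received mass is split: the part near [U] is used with [U], and the rest, necessarily near
   [V], waits. *)
pose TU := thickening U (rad (lam j)).
pose GU := G `&` TU; pose GV := G `\` TU.
have mTU : measurable (TU : set (borel X)) by exact: measurable_thickening.
have mGU : measurable GU by exact: measurableI.
have mGV : measurable GV by exact: measurableD.
have nGUV y : G y -> ~ (OU `|` OV) y.
  by move=> Gy Oy; have : (G `&` (OU `|` OV)) y by []; rewrite GUV.
have GVsub : GV `<=` thickening V (rad (lam j)).
  move=> y [Gy nUy]; have [u [Uu|Vu] uy] := Gsub y Gy; last by exists u.
  by case: nUy; exists u.
have split : G `|` (OU `|` OV) = (GU `|` OU) `|` (GV `|` OV).
  apply/seteqP; split=> y; last first.
    case=> [[[Gy _]|Oy]|[[Gy _]|Oy]];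
      by [left|right; left|left|right; right].
  case=> [Gy|[Oy|Oy]]; [|by left; right|by right; right].
  by have [Ty|nTy] := pselect (TU y); [left; left|right; left].
have disj : (GU `|` OU) `&` (GV `|` OV) = set0.
  apply/seteqP; split=> // y [[[Gy Ty]|Oy] [[Gy' nTy]|Oy']].
  - by [].
  - by case: (nGUV y Gy); right.
  - by case: (nGUV y Gy'); left.
  - by rewrite -OUV; split.
have [|||j1 [H1 [j1N a1 H1sub H1z]]] := fU j GU jN jk mGU.
- by apply/seteqP; split=> // y [[Gy _] Oy]; case: (nGUV y Gy); left.
- by move=> y [].
- apply: le_trans mGUV; apply: le_mass.
  + exact: measurableU.
  + by apply: measurableU => //; exact: measurableU.
  + by rewrite split; exact: subsetUl.
have a1' : alloc mu lam good j (G `|` (OU `|` OV)) j1 (H1 `|` (GV `|` OV)).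
  by rewrite split; exact: alloc_frame.
have mH1 : measurable H1.
  by apply: alloc_measurable a1; exact: measurableU.
have H1disj : H1 `&` (GV `|` OV) = set0.
  by apply/seteqP; split=> // y [/(alloc_sub a1) Hy Gy]; rewrite -disj.
have GVk : GV `<=` thickening V (E * delta ^+ k).
  by apply: subset_trans GVsub _; apply: thickeningS => //; exact: rad_le.
(* If the next weight is already too large for generation [k], stop here: delivery near [z] is no
   longer demanded. *)
have [j1k|kj1] := leP (lam j1) (w k); last first.
  exists j1, (H1 `|` (GV `|` OV)); split=> //; last by move: kj1; lra.
  have OVk : OV `<=` thickening V (E * delta ^+ k).
    by apply: pi_thickening; exact: thick_le.
  by move=> y [/H1sub|[/GVk|/OVk]]; exact: thickeningS.
(* For [V], both the left-over of [U] and the waiting part count as received mass; the latter is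
   still close enough because [rad] and [lam] are monotone. *)
have [||||j2 [H2 [j2N a2 H2sub H2z]]] := fV j1 (H1 `|` GV) j1N j1k.
- exact: measurableU.
- apply/seteqP; split=> // y [[Hy|[Gy _]] Oy]; last by case: (nGUV y Gy); right.
  by rewrite -H1disj; split=> //; right.
- move=> y [/(H1z j1k)|/GVsub]; first exact: ball_thickening.
  apply: thickeningS => //; apply: rad_homo; apply: lam_homo.
  exact: alloc_leq a1.
- have mA : measurable (G `|` (OU `|` OV)).
    by apply: measurableU => //; exact: measurableU.
  have := alloc_mass mA a1'; rewrite -setUA => eqm.
  move: mGUV; rewrite eqm (big_cat_nat (alloc_leq a1) (leqW j1N))/=.
  by rewrite lerD2l.
exists j2, H2; split=> //.
- by apply: alloc_trans a1' _; rewrite setUA.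
- by apply: subset_trans H2sub _; apply: thickeningS => //; right.
Qed.

(** If the next weight is small for generation [k.+1], the finer filling is run. Otherwise it lies
    between [w k.+1] and [w k], and the cube is drained as a whole. *)
Lemma fillable_refine k x Q z : (k <= K)%N -> w k < mass mu (own Q) ->
  Q `<=` ball x (C * delta ^+ k) -> closure Q z ->
  fillable k.+1 Q z -> fillable k Q z.
Proof.
move=> kK wQ Qx clz fQ j G jN jk mG GQ Gsub mGQ.
have dk : 0 < delta ^+ k by rewrite exprn_gt0.
have Qz : Q `<=` ball z (3 * (C * delta ^+ k)).
  exact: closure_sub_ball (mulr_gt0 C_gt0 dk) Qx clz.
have Ek r : r <= E * delta ->
    3 * (C * delta ^+ k) + r * delta ^+ k <= E * delta ^+ k.
  move=> rE; rewrite mulrA -mulrDl ler_pM2r//; move: rE E_step; lra.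
have [jk1|k1j] := leP (lam j) (w k.+1).
  have [j' [H [j'N aH Hsub Hz]]] := fQ j G jN jk1 mG GQ Gsub mGQ.
  have Hk : H `<=` thickening Q (E * delta ^+ k).
    apply: subset_trans Hsub _; apply: thickeningS => //.
    rewrite exprS mulrA ler_pM2r//; move: E_step C_gt0; lra.
  (* When the finer filling stops at a weight above [w k.+1], all of [Q] is within the scale of that
     weight from [z], so the left-over is already near [z]. *)
  exists j', H; split=> // j'k; have [/Hz//|k1j'] := leP (lam j') (w k.+1).
  apply: subset_trans Hsub _; apply: subset_trans (thickening_ball Qz) _.
  apply: le_ball; rewrite exprS [E * (_ * _)]mulrA (le_trans (Ek _ (lexx _)))//.
  exact: rad_ge.
have Gk : G `<=` thickening Q (E * delta ^+ k).
  by apply: subset_trans Gsub _; apply: thickeningS => //; exact: rad_le.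
have GOk : G `|` own Q `<=` thickening Q (E * delta ^+ k).
  by move=> y [/Gk//|Oy]; apply: pi_thickening Oy; exact: thick_le.
have [|j' [H [j'N aH HO]]] := @alloc_drain _ _ _ mu lam good N (w k) j G
  (own Q) div mG (measurable_pi Q) GQ wQ lam_gt0 jN mGQ.
  move=> i Y ji YGO; exists x; apply: subset_trans YGO _.
  apply: subset_trans GOk _; apply: subset_trans (thickening_ball Qx) _.
  apply: le_ball; rewrite -mulrDl addrC; apply: radius_ge => //.
  by apply: lt_le_trans k1j _; exact: lam_homo.
exists j', H; split=> //; first by apply: subset_trans GOk; exact: alloc_sub aH.
move=> j'k; case: HO => [HO|]; last by move: j'k; lra.
apply: subset_trans HO _; apply: subset_trans (pi_thickening (eps_le kK)) _.
apply: subset_trans (thickening_ball Qz) _; apply: le_ball.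
apply: (@le_trans _ _ (E * delta ^+ k)); last first.
  apply: rad_ge => //; apply: lt_le_trans k1j _.
  by apply: lam_homo; exact: alloc_leq aH.
by rewrite mulrA -mulrDl ler_pM2r//; move: E_ge; lra.
Qed.

Variables (I : nat -> Type) (Q : forall k, I k -> set X).
Hypothesis Q_cover : forall k, disjoint_union [set: X] (@Q k).
Hypothesis Q_nested : forall k l (a : I l) (b : I k), (k <= l)%N ->
  Q a `<=` Q b \/ Q a `&` Q b = set0.
Hypothesis Q_ball : forall k (a : I k), exists2 x, Q a x &
  Q a `<=` ball x (C * delta ^+ k).
Hypothesis Q_connected : forall k (a : I k), connected (Q a).
Hypothesis I_finite : forall k, finite_set [set: I k].
Hypothesis Q_mass : forall k (a : I k), (k <= K)%N -> w k < mass mu (own (Q a)).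

(** Stated for a set [D] of cubes so as to serve both the children of one cube and the whole
    space. *)
Lemma fillable_bigcup k (D : set (I k)) z : (k <= K)%N ->
  (forall (a : I k) x, closure (Q a) x -> fillable k (Q a) x) ->
  connected (\bigcup_(a in D) Q a) -> closure (\bigcup_(a in D) Q a) z ->
  fillable k (\bigcup_(a in D) Q a) z.
Proof.
move=> kK fQ; have [m [g ginj <-]] : exists m, exists2 g : 'I_m -> I k,
    injective g & range g = D.
  exact: (@finite_set_enum _ D (sub_finite_set (@subsetT _ D) (I_finite k))).
rewrite bigcup_image => cU clz.
apply: (@connected_gluing _ m (fun i => Q (g i)) (fillable k)) => //.
- by move=> i; have [x] := Q_ball (g i); exists x.
- move=> i j _ _ ij; apply: ginj; have [_ trivQ] := Q_cover k.
  exact: trivQ.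
- by move=> i x; exact: fQ.
- by move=> U V z' x; exact: fillableU.
Qed.

(** Induction from the finest generation to the coarsest: children are glued into a union fillable
    at generation [k.+1], which is then refined to [k]. *)
Lemma fillable_cube n k (a : I k) z : (k + n)%N = K.+1 -> closure (Q a) z ->
  fillable k (Q a) z.
Proof.
have last m U y : m = K.+1 -> fillable m U y.
  by move=> ->; exact: fillable_last.
elim: n k a z => [|n ih] k a z knK.
  by move=> _; apply: last; rewrite -knK addn0.
have kK : (k <= K)%N by rewrite -ltnS -knK addnS ltnS leq_addr.
move=> clz; have [x Qx Qsub] := Q_ball a.
apply: (@fillable_refine k x) => //; first exact: Q_mass.
have [k1K|] := ltnP k K; last first.
  by move=> Kk; apply: last; congr _.+1; apply/eqP; rewrite eqn_leq kK.
have QU : Q a = \bigcup_(b in [set b : I k.+1 | Q b `<=` Q a]) Q b.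
  apply/seteqP; split=> y; last by case=> b /= Qba /Qba.
  move=> Qy; have [QT _] := Q_cover k.+1.
  have [b _ Qb] : (\bigcup_(b in [set: I k.+1]) Q b) y by rewrite -QT.
  exists b => //=; have [//|Qba] := Q_nested b a (leqnSn k).
  by have : (Q b `&` Q a) y by []; rewrite Qba.
rewrite QU; apply: fillable_bigcup => //.
- by move=> b y; apply: ih; rewrite addSnnS.
- by rewrite -QU.
- by rewrite -QU.
Qed.

Lemma fillable_setT z : connected [set: X] -> fillable 0 [set: X] z.
Proof.
have [QT _] := Q_cover 0; rewrite QT => cX.
apply: fillable_bigcup => // [a x|]; first exact: (@fillable_cube K.+1).
by rewrite -QT; exact: subset_closure.
Qed.

Hypothesis rad_attained : forall t, w K.+1 < t ->
  exists k, [/\ (k <= K)%N, w k.+1 < t & rad t <= E * delta ^+ k].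
Hypothesis radius_large : forall i z, w 0 < lam i ->
  ball z (radius i) = [set: X].

(** Filling [X] at generation 0 with nothing received leaves a region no larger than the next weight
    allows. All later weights are at least as large, so they may be cut from it arbitrarily. *)
Lemma alloc_setT : connected [set: X] ->
  mass mu [set: borel X] = \sum_(0 <= i < N.+1) lam i ->
  alloc mu lam good 0 [set: borel X] N.+1 set0.
Proof.
move=> cX massX; pose z : X := point.
have mX : measurable [set: borel X] by exact: measurableT.
suff [j [H [jN aH HE]]] : exists j (H : set (borel X)), [/\ (j <= N)%N,
    alloc mu lam good 0 [set: borel X] j H &
    lam j <= w 0 -> H `<=` ball z (rad (lam j))].
  have mH : measurable H by exact: alloc_measurable aH.
  apply: (alloc_trans aH); apply: alloc_all => //.
    have := alloc_mass mX aH; rewrite massX.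
    rewrite (big_cat_nat (alloc_leq aH) (leqW jN))/= => /addrI <-.
    by [].
  move=> i Y ji YH; exists z.
  have [ij|ij] := leP (lam j) (w 0); last first.
    by rewrite radius_large//; apply: lt_le_trans ij _; exact: lam_homo.
  apply: subset_trans YH _; apply: subset_trans (HE ij) _; apply: le_ball.
  have [|k [kK kj radk]] := @rad_attained (lam j).
    by apply: lt_le_trans wK _; exact: lam_homo.
  apply: le_trans radk _; apply: (@le_trans _ _ ((E + C) * delta ^+ k)).
    by rewrite ler_pM2r ?exprn_gt0// lerDl ltW.
  by apply: radius_ge => //; apply: lt_le_trans kj _; exact: lam_homo.
have [l0|l0] := leP (lam 0) (w 0); last first.
  exists 0, [set: borel X]; split=> //; first exact: alloc_nil.
  by move=> l0'; move: l0 l0'; lra.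
have [||||j [H [jN aH _ HE]]] := @fillable_setT z cX 0 set0 (leq0n N) l0.
- exact: measurable0.
- by rewrite set0I.
- by [].
- by rewrite set0U /own preimage_setT massX.
by exists j, H; split=> //; move: aH; rewrite set0U /own preimage_setT.
Qed.

End Filling.

(** * Consequences of Ahlfors regularity *)

Lemma exists_expr_lt (R : realType) (x e : R) : 0 < x < 1 -> 0 < e ->
  exists k, x ^+ k < e.
Proof.
move=> /andP[x0 x1] e0.
have x1' : `|x| < 1 by rewrite ger0_norm// ltW.
have /cvgrPdist_lt/(_ e e0) := cvg_expr x1'.
move=> [k _ /(_ k)] /=; rewrite leqnn => /(_ isT).
rewrite sub0r normrN ger0_norm; first by exists k.
by rewrite exprn_ge0// ltW.
Qed.

Lemma powRVK (R : realType) (d a : R) : 0 < d -> 0 <= a -> (a `^ d^-1) `^ d = a.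
Proof. by move=> d0 a0; rewrite -powRrM mulVf ?powRr1// gt_eqF. Qed.

Lemma powRKV (R : realType) (d a : R) : 0 < d -> 0 <= a -> (a `^ d) `^ d^-1 = a.
Proof. by move=> d0 a0; rewrite -powRrM mulfV ?powRr1// gt_eqF. Qed.

(** Total boundedness. *)
Definition finite_nets (R : realType) (X : metricPType R) :=
  forall r : R, 0 < r ->
  exists s : seq X, forall y, exists2 c, c \in s & ball c r y.

Section Regular.
Context {R : realType} {X : metricPType R}.
Variable mu : {finite_measure set (borel X) -> \bar R}.
Variables (d A diamX : R).
Hypothesis d_gt0 : 0 < d.
Hypothesis A_ge1 : 1 <= A.

Lemma regular_diam_fin :
  (forall (x : X) r, 0 < r -> (r%:E <= diam X)%E ->
    A^-1 * r `^ d <= mass mu (ball x r)) ->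
  (exists x y : X, x <> y) ->
  exists D, [/\ 0 < D, diam X = D%:E & forall x y : X, mdist x y <= D].
Proof.
move=> low [x [y /eqP xy]].
have A0 : 0 < A by rewrite (lt_le_trans ltr01).
have dist_le (u v : X) : ((mdist u v)%:E <= diam X)%E.
  by apply: ereal_sup_ubound; exists (u, v).
have xyD := dist_le x y; case E : (diam X) xyD => [D| |] xyD //.
- exists D; split=> //.
    by apply: lt_le_trans (_ : mdist x y <= D); rewrite ?mdist_gt0// -lee_fin.
  by move=> u v; rewrite -lee_fin -E.
- pose M := mass mu [set: borel X].
  have M0 : 0 < M + 1 by rewrite ltr_wpDl// mass_ge0.
  have AM0 : 0 < A * (M + 1) by rewrite mulr_gt0.
  (* With infinite diameter the lower bound holds at every radius; this one makes it equal to
     [M + 1], more than the total mass. *)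
  have := low x ((A * (M + 1)) `^ d^-1) (powR_gt0 _ AM0).
  rewrite E leey powRVK ?(ltW AM0)// mulKf ?gt_eqF// => /(_ isT).
  have : mass mu (ball x ((A * (M + 1)) `^ d^-1)) <= M.
    by apply: le_mass => //; apply: open_borel; exact: open_metric_ball.
  by move=> /[swap] /le_trans/[apply]; rewrite gerDl ler10.
Qed.

Hypothesis diamX_gt0 : 0 < diamX.
Hypothesis mass_lower : forall (x : X) r, 0 < r <= diamX ->
  A^-1 * r `^ d <= mass mu (ball x r).
Hypothesis mass_upper : forall (x : X) r, 0 < r <= diamX ->
  mass mu (ball x r) <= A * r `^ d.

Let A_gt0 : 0 < A. Proof. exact: lt_le_trans A_ge1. Qed.

Let mball (x : X) r : measurable (ball x r : set (borel X)).
Proof. by apply: open_borel; exact: open_metric_ball. Qed.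

Lemma disjoint_balls_finite (J : Type) (c : J -> X) r : 0 < r ->
  trivIset [set: J] (fun a => ball (c a) r) -> finite_set [set: J].
Proof.
move=> r0 triv; pose s := Num.min r diamX.
have s0 : 0 < s by rewrite lt_min r0.
have sr : s <= r by rewrite /s ge_min lexx.
apply: (@finite_disjoint_mass _ _ _ mu J (fun a => ball (c a) r)
  (A^-1 * s `^ d)).
- by rewrite mulr_gt0 ?invr_gt0// powR_gt0.
- by move=> a; exact: mball.
- exact: triv.
- move=> a; apply: le_trans (@mass_lower (c a) s _) _.
    by rewrite s0 /s ge_min lexx orbT.
  by apply: le_mass; [exact: mball|exact: mball|exact: le_ball].
Qed.

Lemma finely_divisible_nets : finite_nets X -> finely_divisible mu.
Proof.
(* Chosen so that [A * r ^ d <= e], within the range where the upper bound holds. *)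
move=> nets e e0; pose r := Num.min diamX ((e / A) `^ d^-1).
have eA : 0 < e / A by rewrite divr_gt0.
have r0 : 0 < r by rewrite lt_min diamX_gt0 powR_gt0.
have [s cover] := nets r r0.
exists (size s), (fun i => ball (nth point s i) r); split=> [i|i|].
- exact: mball.
- apply: le_trans (mass_upper _ _) _; first by rewrite r0 /r ge_min lexx.
  rewrite mulrC -ler_pdivlMr// -[leRHS](powRVK d_gt0) ?(ltW eA)//.
  apply: ge0_ler_powR; [exact: ltW|exact: ltW|exact: powR_ge0|].
  by rewrite /r ge_min lexx orbT.
- apply/seteqP; split=> // y _.
  rewrite -(bigcup_mkord _ (fun i => ball (nth point s i) r)).
  have [c cs cy] := cover y; exists (index c s); first by rewrite /= index_mem.
  by rewrite nth_index.
Qed.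

(** Each point goes to the centre of the disjointed ball containing it. Since [pi] is constant on
    countably many Borel pieces, every preimage is Borel. *)
Lemma discretization (e : R) : finite_nets X -> 0 < e ->
  exists pi : X -> X,
    (forall U : set X, measurable (pi @^-1` U : set (borel X))) /\
    (forall y, mdist (pi y) y < e).
Proof.
move=> nets e0; have [s cover] := nets e e0.
pose B i : set (borel X) := ball (nth point s i) e.
have BT : \bigcup_i seqDU B i = setT.
  rewrite -seqDU_bigcup_eq; apply/seteqP; split=> // y _.
  by have [c cs cy] := cover y; exists (index c s); rewrite // /B nth_index.
have /choice[p pP] (y : X) : exists i, seqDU B i y.
  have [i _ Di] : (\bigcup_i seqDU B i) y by rewrite BT.
  by exists i.
exists (fun y => nth point s (p y)); split=> [U|y]; last first.
  by have := subset_seqDU (pP y); rewrite /B ballEmdist.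
have -> : (fun y => nth point s (p y)) @^-1` U =
    \bigcup_(i in [set i | U (nth point s i)]) seqDU B i.
  apply/seteqP; split=> [y Uy|y [i Ui Di]]; first by exists (p y).
  have ip : i = p y by apply: (@trivIset_seqDU _ B) => //; exists y; split.
  by rewrite /preimage/= -ip.
apply: bigcup_measurable => i _; apply: seqDU_measurable => j; exact: mball.
Qed.

End Regular.

(** * Ordering the weights and matching them with scales *)

Lemma sorted_weights (R : realType) N (lambda : 'I_N.+1 -> R) :
  exists (lam : nat -> R) (f : 'I_N.+1 -> nat),
  [/\ {homo lam : i j / (i <= j)%N >-> i <= j},
      forall i, exists j, lam i = lambda j,
      forall i, (f i <= N)%N /\ lam (f i) = lambda i,
      injective f &
      (forall l, (l <= N)%N -> exists i, f i = l) /\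
      \sum_(0 <= i < N.+1) lam i = \sum_i lambda i].
Proof.
pose leT (i j : 'I_N.+1) := lambda i <= lambda j.
pose s := sort leT (enum 'I_N.+1).
have ss : size s = N.+1 by rewrite size_sort size_enum_ord.
have us : uniq s by rewrite sort_uniq enum_uniq.
have ms i : i \in s by rewrite mem_sort mem_enum.
have leTT : transitive leT by move=> j i k; exact: le_trans.
have sorteds : sorted leT s by apply: sort_sorted => i j; exact: le_total.
have fN i : (index i s <= N)%N by rewrite -ltnS -[ltnRHS]ss index_mem.
(* Past [N] the largest weight is repeated, which keeps the sequence monotone. Sorting indices
   rather than values makes positions distinct even for equal weights. *)
exists (fun i => lambda (nth ord0 s (minn i N))), (fun i => index i s); split.
- move=> i j ij.
  apply: (sorted_leq_nth leTT (fun i => lexx (lambda i)) ord0 sorteds).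
  + by rewrite inE ss ltnS geq_minr.
  + by rewrite inE ss ltnS geq_minr.
  + by rewrite leq_min geq_minr andbT (leq_trans (geq_minl _ _)).
- by move=> i; eexists.
- by move=> i; split=> //; rewrite (minn_idPl (fN i)) nth_index.
- by move=> i j ij; rewrite -(nth_index ord0 (ms i)) ij nth_index.
- split=> [l lN|]; first by exists (nth ord0 s l); rewrite index_uniq ?ss.
  transitivity (\sum_(i <- s) lambda i).
    rewrite (big_nth ord0) ss !big_mkord; apply: eq_bigr => i _.
    by rewrite (minn_idPl _)// -ltnS.
  by rewrite (perm_big (enum 'I_N.+1)) ?perm_sort// big_enum.
Qed.

(* The witness is [E * delta ^+ k] for the last [k <= K] with [t <= w k], and
   [k = 0] if there is none. *)
Lemma scale_function (R : realType) (w : nat -> R) (E delta : R) (K : nat) :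
  0 <= E -> 0 < delta < 1 -> {homo w : i j / (i <= j)%N >-> j <= i} ->
  exists rad : R -> R, [/\ {homo rad : s t / s <= t},
    forall k t, (k <= K)%N -> t <= w k -> rad t <= E * delta ^+ k,
    forall k t, (k <= K)%N -> w k.+1 < t -> E * delta ^+ k <= rad t &
    forall t, w K.+1 < t -> exists k,
      [/\ (k <= K)%N, w k.+1 < t & rad t <= E * delta ^+ k]].
Proof.
move=> E0 /andP[d0 d1] w_homo.
pose lev t := \max_(l < K.+1 | t <= w l) (l : nat).
have le_lev k t : (k <= K)%N -> t <= w k -> (k <= lev t)%N.
  by move=> kK tk; apply: (@bigop.bigmax_sup _ (Ordinal (kK : (k < K.+1)%N))).
have lev_le k t : (forall l, (l <= K)%N -> t <= w l -> (l <= k)%N) ->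
    (lev t <= k)%N.
  by move=> lk; apply/bigmax_leqP => l tl; apply: lk => //; rewrite -ltnS.
have expE k l : (k <= l)%N -> E * delta ^+ l <= E * delta ^+ k.
  by move=> kl; rewrite ler_wpM2l// ler_wiXn2l// ltW.
exists (fun t => E * delta ^+ lev t); split.
- move=> s t st; apply: expE; apply: lev_le => l lK tl.
  by apply: le_lev => //; exact: le_trans tl.
- by move=> k t kK tk; apply: expE; exact: le_lev.
- move=> k t kK kt; apply: expE; apply: lev_le => l lK tl.
  rewrite leqNgt; apply/negP => kl.
  by have := le_trans tl (w_homo _ _ kl); rewrite leNgt kt.
- move=> t Kt; have levK : (lev t <= K)%N by exact: lev_le.
  exists (lev t); split=> //; rewrite ltNge; apply/negP => tw.
  have [lK|Kl] := ltnP (lev t) K.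
    by have := le_lev _ _ lK tw; rewrite ltnn.
  have lK : lev t = K by apply/eqP; rewrite eqn_leq levK.
  by move: tw; rewrite lK leNgt Kt.
Qed.

(** * Choice of constants and assembly *)

Theorem theorem1p2 (R : realType) (X : metricPType R)
    (mu : {finite_measure set (borel X) -> \bar R}) (d : R) :
  (exists x y : X, x <> y) ->
  connected [set: X] ->
  admits_connected_dyadic_cubes X ->
  0 < d ->
  ahlfors_david_regular mu d ->
  admits_weighted_decomposition mu d.
Proof.
move=> neq cX [I [Q [[C [delta [C0 d01 cover nested centers]]] conn]]] d0.
move=> [A A1 reg]; have A0 : 0 < A by exact: lt_le_trans A1.
have /andP[delta0 delta1] := d01.
have mball (x : X) r : measurable (ball x r : set (borel X)).
  by apply: open_borel; exact: open_metric_ball.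
have low0 (x : X) r : 0 < r -> (r%:E <= diam X)%E ->
    A^-1 * r `^ d <= mass mu (ball x r).
  by move=> r0 /(reg x r r0)[+ _]; rewrite -lee_fin -massE.
have [D [D0 DE dist_le]] := regular_diam_fin d0 A1 low0 neq.
have low (x : X) r : 0 < r <= D -> A^-1 * r `^ d <= mass mu (ball x r).
  by case/andP=> r0 rD; apply: low0; rewrite ?DE.
have upp (x : X) r : 0 < r <= D -> mass mu (ball x r) <= A * r `^ d.
  case/andP=> r0 rD; have [|_] := reg x r r0; first by rewrite DE lee_fin.
  by rewrite -lee_fin -massE.
have dk k : 0 < delta ^+ k by rewrite exprn_gt0.
pose c k (a : I k) := sval (cid (centers k a)).
have cP k (a : I k) : [/\ Q k a (c k a),
    ball (c k a) (C^-1 * delta ^+ k) `<=` Q k a &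
    Q k a `<=` ball (c k a) (C * delta ^+ k)].
  exact: svalP (cid (centers k a)).
have Ifin k : finite_set [set: I k].
  apply: (disjoint_balls_finite A1 D0 low (c := c k) (r := C^-1 * delta ^+ k)).
    by rewrite mulr_gt0 ?invr_gt0.
  move=> a b _ _ [y [ay yb]]; have [_ trivQ] := cover k.
  apply: trivQ => //; exists y; split.
    by have [_ + _] := cP k a; apply.
  by have [_ + _] := cP k b; apply.
have nets : finite_nets X.
  move=> r r0; have [k dkr] := exists_expr_lt d01 (divr_gt0 r0 C0).
  have [m [g _ gT]] := finite_set_enum (Ifin k).
  exists [seq c k (g i) | i <- enum 'I_m] => y.
  have [QT _] := cover k.
  have [a _ Qay] : (\bigcup_a Q k a) y by rewrite -QT.
  have [i _ gia] : range g a by rewrite gT.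
  exists (c k a); first by rewrite -gia map_f// mem_enum.
  have [_ _ /(_ y Qay)] := cP k a; apply: le_ball.
  by rewrite mulrC -ler_pdivlMr// ltW.
have div := finely_divisible_nets d0 A1 D0 upp nets.
pose E := 4 * C / (1 - delta).
have E0 : 0 < E by rewrite divr_gt0 ?mulr_gt0// subr_gt0.
(* Half the inner radius of a cube leaves room for the displacement by [pi]; [D] keeps the radii in
   the range of regularity. The factor 2 in [cA] makes the mass inequality strict. *)
pose c0 := Num.min (C^-1 / 2) D.
have c00 : 0 < c0 by rewrite lt_min D0 andbT divr_gt0// invr_gt0.
pose cA := (2 * A)^-1.
have cA0 : 0 < cA by rewrite invr_gt0 mulr_gt0.
(* [w k] is strictly less than the mass of every cube of generation [k <= K]. *)
pose w k := cA * (c0 * delta ^+ k) `^ d.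
pose beta := cA `^ d^-1 * c0.
have beta0 : 0 < beta by rewrite mulr_gt0 ?powR_gt0.
have w0 k : 0 < w k by rewrite mulr_gt0// powR_gt0// mulr_gt0.
have w_root k : w k `^ d^-1 = beta * delta ^+ k.
  rewrite powRM ?powR_ge0 ?(ltW cA0)// powRKV ?mulrA//.
  by rewrite mulr_ge0 ?ltW.
clearbody beta; have id0 : 0 < d^-1 by rewrite invr_gt0.
have root_lt k t : w k < t -> beta * delta ^+ k < t `^ d^-1.
  move=> wt; rewrite -w_root; apply: gt0_ltr_powR => //; rewrite nnegrE ltW//.
  exact: lt_trans wt.
have w_homo : {homo w : i j / (i <= j)%N >-> j <= i}.
  move=> i j ij; rewrite ler_pM2l//; apply: ge0_ler_powR; first exact: ltW.
  - by rewrite nnegrE mulr_ge0 ?ltW.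
  - by rewrite nnegrE mulr_ge0 ?ltW.
  - by rewrite ler_pM2l// ler_wiXn2l// ltW.
(* Chosen so that [Cst * t ^ (1/d)] exceeds [(E + C) * delta ^ k] as soon as
   [w k.+1 < t], and exceeds [diam X] as soon as [w 0 < t]. *)
pose Cst := (E + C + D + 1) / (beta * delta).
have Cst0 : 0 < Cst.
  by apply: divr_gt0; [move: E0 C0 D0; lra|exact: mulr_gt0].
have CstE : Cst * beta * delta = E + C + D + 1.
  by rewrite -mulrA /Cst mulfVK// gt_eqF// mulr_gt0.
clearbody Cst; exists Cst => // -[|N] lambda lambda0 sumE.
  (* Without weights the total mass would be 0, yet a ball of radius [D] has positive mass. *)
  have := low point D; rewrite D0 lexx => /(_ isT).
  have m0 : mass mu [set: borel X] = 0 by rewrite /mass -sumE big_ord0.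
  have := @le_mass _ _ _ mu _ _ (mball point D) measurableT (@subsetT _ _).
  rewrite m0 => /[swap] /le_trans/[apply]; rewrite leNgt.
  by rewrite mulr_gt0 ?invr_gt0 ?powR_gt0.
have [lam [f [lam_homo lamE fE finj [fsurj lam_sum]]]] := sorted_weights lambda.
have lam0 i : 0 < lam i by have [j ->] := lamE i.
(* The depth [K] depends on the smallest weight, whereas [Cst] was fixed before the weights. *)
have [K wK] : exists K, w K.+1 < lam 0%N.
  have [k dkl] :=
    exists_expr_lt d01 (divr_gt0 (powR_gt0 d^-1 (lam0 0%N)) beta0).
  exists k; apply: le_lt_trans (w_homo _ _ (leqnSn k)) _.
  rewrite ltNge; apply/negP => lw; move: dkl.
  rewrite ltr_pdivlMr// mulrC -w_root ltNge => /negP; apply.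
  by apply: ge0_ler_powR => //; rewrite ?nnegrE ltW.
have [rad [rad_homo rad_le rad_ge rad_att]] :=
  scale_function K (ltW E0) d01 w_homo.
pose eps := Num.min C (C^-1 / 2) * delta ^+ K.
have eps0 : 0 < eps by rewrite mulr_gt0// lt_min C0 divr_gt0 ?invr_gt0.
have [pi [mpi pi_near]] := discretization nets eps0.
pose radius i := Cst * lam i `^ d^-1.
have radius_ge k i : (k <= K)%N -> w k.+1 < lam i ->
    (E + C) * delta ^+ k <= radius i.
  move=> _ /root_lt/ltW; rewrite -(ler_pM2l Cst0); apply: le_trans.
  rewrite exprS !mulrA CstE ler_pM2r// -addrA lerDl; move: D0; lra.
have radius_large i z : w 0%N < lam i -> ball z (radius i) = [set: X].
  move=> /root_lt/ltW; rewrite expr0 mulr1 -(ler_pM2l Cst0) => le_radius.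
  apply/seteqP; split=> // y _; rewrite ballEmdist/=.
  apply: le_lt_trans (dist_le z y) _; apply: lt_le_trans le_radius.
  have : Cst * beta * delta <= Cst * beta by rewrite ler_piMr ?mulr_ge0 ?ltW.
  by rewrite CstE; apply: lt_le_trans; move: E0 C0; lra.
have epsK : eps <= C * delta ^+ K.
  by rewrite ler_pM2r// /eps ge_min lexx.
(* [pi] maps the ball of radius [c0 * delta ^+ k] about the centre into the inner ball of the
   cube. *)
have Q_mass k (a : I k) : (k <= K)%N -> w k < mass mu (pi @^-1` Q k a).
  move=> kK; have Kk : delta ^+ K <= delta ^+ k by rewrite ler_wiXn2l// ltW.
  have r0 : 0 < c0 * delta ^+ k by rewrite mulr_gt0.
  have rD : c0 * delta ^+ k <= D.
    apply: (@le_trans _ _ c0); last by rewrite /c0 ge_min lexx orbT.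
    by apply: ler_piMr; [exact: ltW|rewrite exprn_ile1// ltW].
  have : w k < A^-1 * (c0 * delta ^+ k) `^ d.
    rewrite ltr_pM2r ?powR_gt0// ltf_pV2 ?posrE ?mulr_gt0//.
    by move: A0; lra.
  move=> /lt_le_trans; apply; apply: le_trans (low (c k a) _ _) _.
    by apply/andP; split.
  apply: le_mass; [exact: mball|exact: mpi|move=> y cy].
  have [_ + _] := cP k a; apply.
  rewrite ballEmdist/= metric_sym; apply: le_lt_trans (metric_triangle _ y _) _.
  move: cy; rewrite ballEmdist/= => cy.
  rewrite [in ltRHS](splitr C^-1) mulrDl; apply: ltrD; last first.
    rewrite metric_sym; apply: lt_le_trans cy _.
    by rewrite ler_pM2r// /c0 ge_min lexx.
  apply: lt_le_trans (pi_near y) _.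
  apply: (@le_trans _ _ (C^-1 / 2 * delta ^+ K)).
    by rewrite ler_pM2r// ge_min lexx orbT.
  by rewrite ler_pM2l// divr_gt0 ?invr_gt0.
have Q_ball k (a : I k) : exists2 x,
    Q k a x & Q k a `<=` ball x (C * delta ^+ k).
  by have [x [Qx _ Qsub]] := centers k a; exists x.
have mass_sum : mass mu [set: borel X] = \sum_(0 <= i < N.+1) lam i.
  by apply: EFin_inj; rewrite -massE// lam_sum sumE.
have aT := alloc_setT div lam0 lam_homo C0 d01 wK rad_homo rad_le rad_ge mpi
  pi_near epsK radius_ge cover nested Q_ball conn Ifin Q_mass rad_att
  radius_large cX mass_sum.
have [Z [Zl Ztriv ZT]] := alloc_pieces aT.
have Zf j := Zl (f j); have fN j : (0 <= f j < N.+1)%N by have [] := fE j.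
(* [f] restores the original numbering of the weights. *)
exists (fun j => Z (f j)); split.
- by move=> j; have [] := Zf j (fN j).
- split.
    rewrite -[LHS]setD0 ZT; apply/seteqP; split=> x.
      by move=> [l /= lN Zx]; have [j fj] := fsurj l lN; exists j; rewrite ?fj.
    by move=> [j _ Zx]; exists (f j) => //=; exact: fN.
  move=> i j _ _ ij; apply: finj; apply: Ztriv => //=; exact: fN.
- move=> j; have [mZ Zm _] := Zf j (fN j).
  by have [_ <-] := fE j; rewrite -Zm -massE.
- move=> j; have [_ _ [x Zx]] := Zf j (fN j); exists x.
  by have [_ <-] := fE j.
Qed.
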